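(* Let $G$ be a finite group and let $H$ be an abelian subgroup of $G$. Let $A=\mathbb C[x_g]G$, $B=\mathbb C[x_g]H$, let $\mathfrak X_G=\sum_{g\in G}x_g g\in A$, and write $\Theta(G:H):=\mathrm{Sdet}_{\mathrm{M}(1,A)}^{B}(\mathfrak X_G)\in B$. Then $$\Theta(G)1_G=\prod_{\varphi\in\widehat G}\det\big(\varphi(\mathfrak X_G)\big)^{\deg\varphi}=\prod_{\chi\in\widehat H}\chi\big(\Theta(G:H)\big)\in\mathbb C[x_g]G,$$ where $\det(\varphi(\mathfrak X_G))$ is the determinant of a $\deg\varphi\times\deg\varphi$ matrix over the commutative ring $\mathbb C[x_g]H$.
   Context: $\{x_g\mid g\in G\}$ are independent commuting variables and $\mathbb C[x_g]$ is the polynomial ring in them over $\mathbb C$. For a subgroup $K\le G$, $\mathbb C[x_g]K=\{\sum_{k\in K}c_kk\mid c_k\in\mathbb C[x_g]\}$ is the group algebra of $K$ over $\mathbb C[x_g]$; $1_G$ is the unit of $G$. The group determinant is $\Theta(G)=\det(x_{gh^{-1}})_{g,h\in G}\in\mathbb C[x_g]$. $\widehat G$ (resp. $\widehat H$) is a complete set of inequivalent irreducible representations of $G$ (resp. $H$) over $\mathbb C$. A representation $\varphi$ is extended $\mathbb C[x_g]$-linearly: $\varphi(\sum_g c_gg)=\sum_g c_g\varphi(g)$ with $c_g\in\mathbb C[x_g]$; scalars $c\in\mathbb C[x_g]$ are identified with $c\,1_G\in\mathbb C[x_g]\{1_G\}\subset\mathbb C[x_g]H\subset\mathbb C[x_g]G$,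 so $\varphi(\mathfrak X_G)$ is regarded as a matrix over $\mathbb C[x_g]H$ and $\chi(\Theta(G:H))$ as an element of $\mathbb C[x_g]G$. Study-type determinant (case $r=1$): for a commutative ring $B$ and a ring $A\supset B$ with $A=\bigoplus_{i=1}^m e_iB$ free as a right $B$-module, the left regular representation $L_e:A\to \mathrm{M}(m,B)$, $a\mapsto(b_{ij})$, is defined by $ae_j=\sum_ie_ib_{ij}$, and $\mathrm{Sdet}_{\mathrm{M}(1,A)}^B(a)=\det(L_e(a))\in B$ (independent of the choice of basis). Here $\mathbb C[x_g]G$ is a free right $\mathbb C[x_g]H$-module of rank $[G:H]$ (a basis is given by representatives of the left cosets of $H$). *)

(* Defs.v *)
From HB Require Import structures.
From mathcomp Require Import all_boot all_order all_algebra all_fingroup.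
From mathcomp Require Import all_character.
From mathcomp Require Import reals complex.
From mathcomp Require Import mpoly.

Set Implicit Arguments.
Unset Strict Implicit.
Unset Printing Implicit Defensive.

Import GRing.Theory.

Local Open Scope ring_scope.

(* The group algebra P[gT]: an element is its family of coefficients.  The
   alias hides the pointwise product that {ffun gT -> P} carries by default. *)
Definition group_alg (P : comNzRingType) (gT : finGroupType) : Type :=
  {ffun gT -> P}.

Section GroupAlgebra.

Variables (P : comNzRingType) (gT : finGroupType).

Local Notation A := (group_alg P gT).

HB.instance Definition _ := Choice.copy A {ffun gT -> P}.
HB.instance Definition _ := GRing.Lmodule.copy A {ffun gT -> P^o}.

Definition coefg (a : A) : gT -> P := (a : {ffun gT -> P}).

Definition group_alg_of (f : gT -> P) : A := [ffun g => f g].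

Definition delta_alg (g : gT) : A := group_alg_of (fun x => (x == g)%:R).

Definition mul_alg (a b : A) : A :=
  group_alg_of (fun g => \sum_(h : gT) coefg a h * coefg b (h^-1 * g)%g).

Lemma coefgE f g : coefg (group_alg_of f) g = f g.
Proof. by rewrite /coefg ffunE. Qed.

Lemma coefgD a b g : coefg (a + b) g = coefg a g + coefg b g.
Proof. by rewrite /coefg ffunE. Qed.

Lemma coefgZ c a g : coefg (c *: a) g = c * coefg a g.
Proof. by rewrite /coefg ffunE. Qed.

Lemma coefg0 g : coefg 0 g = 0.
Proof. by rewrite /coefg ffunE. Qed.

Lemma group_algP (a b : A) : coefg a =1 coefg b -> a = b.
Proof. by move=> eq_ab; apply/ffunP. Qed.

Lemma coefg_sum I (r : seq I) (Q : pred I) (F : I -> A) g :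
  coefg (\sum_(i <- r | Q i) F i) g = \sum_(i <- r | Q i) coefg (F i) g.
Proof.
apply: (big_morph (fun a => coefg a g)); first by move=> a b; rewrite coefgD.
exact: coefg0.
Qed.

Fact mul_algA : associative mul_alg.
Proof.
move=> a b c; apply: group_algP => g; rewrite !coefgE.
under eq_bigr do rewrite coefgE big_distrr /=.
under [RHS]eq_bigr do rewrite coefgE big_distrl /=.
rewrite [RHS]exchange_big /=; apply: eq_bigr => h _.
rewrite [RHS](reindex_inj (mulgI h)) /=; apply: eq_bigr => k _.
by rewrite mulKg mulrA invMg mulgA.
Qed.

Fact mul_1alg : left_id (delta_alg 1) mul_alg.
Proof.
move=> a; apply: group_algP => g; rewrite coefgE (bigD1 1%g) //= !coefgE eqxx.
rewrite mul1r invg1 mul1g big1 ?addr0 // => h /negPf h1.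
by rewrite coefgE h1 mul0r.
Qed.

Fact mul_alg1 : right_id (delta_alg 1) mul_alg.
Proof.
move=> a; apply: group_algP => g; rewrite coefgE (bigD1 g) //= !coefgE.
rewrite mulVg eqxx mulr1 big1 ?addr0 // => h hg.
by rewrite coefgE -eq_mulVg1 (negPf hg) mulr0.
Qed.

Fact mul_algDl : left_distributive mul_alg +%R.
Proof.
move=> a b c; apply: group_algP => g; rewrite coefgD !coefgE -big_split /=.
by apply: eq_bigr => h _; rewrite coefgD mulrDl.
Qed.

Fact mul_algDr : right_distributive mul_alg +%R.
Proof.
move=> a b c; apply: group_algP => g; rewrite coefgD !coefgE -big_split /=.
by apply: eq_bigr => h _; rewrite coefgD mulrDr.
Qed.

Fact one_alg_neq0 : delta_alg 1 != 0.
Proof.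
apply/eqP => /(congr1 (fun a => coefg a 1%g)).
by rewrite coefgE coefg0 eqxx => /eqP; rewrite oner_eq0.
Qed.

HB.instance Definition _ := GRing.Zmodule_isNzRing.Build A
  mul_algA mul_1alg mul_alg1 mul_algDl mul_algDr one_alg_neq0.

Lemma coefgM (a b : A) g :
  coefg (a * b) g = \sum_(h : gT) coefg a h * coefg b (h^-1 * g)%g.
Proof. exact: coefgE. Qed.

Lemma coefg1 g : coefg (1 : A) g = (g == 1%g)%:R.
Proof. exact: coefgE. Qed.

Lemma coef_deltaM x (a : A) g :
  coefg (delta_alg x * a) g = coefg a (x^-1 * g)%g.
Proof.
rewrite coefgM (bigD1 x) //= coefgE eqxx mul1r big1 ?addr0 // => h /negPf hx.
by rewrite coefgE hx mul0r.
Qed.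

Fact scale_algAl (c : P) (a b : A) : c *: (a * b) = c *: a * b.
Proof.
apply: group_algP => g; rewrite coefgZ !coefgM big_distrr /=.
by apply: eq_bigr => h _; rewrite coefgZ mulrA.
Qed.

HB.instance Definition _ := GRing.Lmodule_isLalgebra.Build P A scale_algAl.

Fact scale_algAr (c : P) (a b : A) : c *: (a * b) = a * (c *: b).
Proof.
apply: group_algP => g; rewrite coefgZ !coefgM big_distrr /=.
by apply: eq_bigr => h _; rewrite coefgZ mulrCA.
Qed.

HB.instance Definition _ := GRing.Lalgebra_isAlgebra.Build P A scale_algAr.

(* P[K] inside P[gT]: the elements supported on K. *)
Definition supp_alg (K : {group gT}) : {pred A} :=
  fun a => [forall g, (g \notin K) ==> (coefg a g == 0)].

Lemma supp_algP (K : {group gT}) (a : A) :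
  reflect (forall g, g \notin K -> coefg a g = 0) (a \in supp_alg K).
Proof.
apply: (iffP forallP) => [aK g gK | aK g]; last by apply/implyP => /aK ->.
by apply/eqP; exact: (implyP (aK g)).
Qed.

Fact supp_alg_closed (K : {group gT}) : subalg_closed (supp_alg K).
Proof.
split=> [|c a b /supp_algP aK /supp_algP bK|a b /supp_algP aK /supp_algP bK].
- apply/supp_algP => g gK; rewrite coefg1.
  by case: eqP gK => // ->; rewrite group1.
- by apply/supp_algP => g gK; rewrite coefgD coefgZ aK // bK // mulr0 addr0.
apply/supp_algP => g gK; rewrite coefgM big1 // => h _.
have [hK | /aK ->] := boolP (h \in K); last by rewrite mul0r.
by rewrite bK ?mulr0 // groupMl // groupV.
Qed.

HB.instance Definition _ (K : {group gT}) :=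
  GRing.isSubalgClosed.Build P A (supp_alg K) (supp_alg_closed K).

Section Abelian.

Variables (K : {group gT}) (abK : abelian K).

(* P[K] as a type.  The proof that K is abelian is an argument of the type, so
   that P[K] is canonically a commutative ring, and a subring of P[gT]. *)
Definition ab_group_alg of abelian K : Type := {a : A | a \in supp_alg K}.

Local Notation B := (ab_group_alg abK).

HB.instance Definition _ := SubChoice.copy B {a : A | a \in supp_alg K}.
HB.instance Definition _ := [SubChoice_isSubAlgebra of B by <:].

Fact ab_group_algC : commutative (@GRing.mul B).
Proof.
move=> [a aK] [b bK]; apply: val_inj; rewrite !rmorphM /=.
apply: group_algP => g; rewrite !coefgM.
rewrite [RHS](reindex_inj (inj_comp (mulgI g) invg_inj)) /=.
apply: eq_bigr => h _; rewrite invMg invgK mulgKV mulrC.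
have [hK | hK] := boolP (h \in K); last by rewrite (supp_algP _ _ aK) ?mulr0.
have [gK | gK] := boolP (g \in K).
  by congr (coefg b _ * _); apply: (centsP abK); rewrite ?groupV.
rewrite (supp_algP _ _ bK) ?groupMl ?groupV //.
by rewrite (supp_algP _ _ bK) ?groupMr ?groupV.
Qed.

HB.instance Definition _ :=
  GRing.PzRing_hasCommutativeMul.Build B ab_group_algC.

End Abelian.

End GroupAlgebra.

(* A is a ring and B a commutative ring, seen in A through iota; A is regarded
   as a right B-module. *)
Section StudyDeterminant.

Variables (B : comNzRingType) (A : nzRingType) (iota : {rmorphism B -> A}).
Variable m : nat.

Definition right_comb (e : 'I_m -> A) (b : 'cV[B]_m) : A :=
  \sum_i e i * iota (b i 0).

Definition right_basis (e : 'I_m -> A) : Prop :=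
  forall a : A, exists! b : 'cV[B]_m, a = right_comb e b.

Variables (e : 'I_m -> A) (eB : right_basis e).

Fact right_coord_subproof (a : A) : exists b, a == right_comb e b.
Proof. by have [b [/eqP ab _]] := eB a; exists b. Qed.

Definition right_coord (a : A) : 'cV[B]_m := xchoose (right_coord_subproof a).

Lemma right_coordK (a : A) : a = right_comb e (right_coord a).
Proof. exact/eqP/(xchooseP (right_coord_subproof a)). Qed.

Definition left_regular_mx (a : A) : 'M[B]_m :=
  \matrix_(i, j) right_coord (a * e j) i 0.

Lemma left_regular_mxP (a : A) j :
  a * e j = \sum_i e i * iota (left_regular_mx a i j).
Proof.
by rewrite {1}(right_coordK (a * e j)); apply: eq_bigr => i _; rewrite mxE.
Qed.

Definition Sdet (a : A) : B := \det (left_regular_mx a).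

End StudyDeterminant.

(* The rank-[G : K] basis of the group algebra given by left coset
   representatives, so that right_basis is inhabited in the case at hand. *)
Section CosetBasis.

Variables (P : comNzRingType) (gT : finGroupType).
Variables (K : {group gT}) (abK : abelian K).

Local Notation iota := (val : ab_group_alg P abK -> group_alg P gT).

Definition coset_basis (i : 'I_#|lcosets K [set: gT]|) : group_alg P gT :=
  delta_alg P (repr (enum_val i)).

Lemma coset_basis_repr (g : gT) :
  exists i : 'I_#|lcosets K [set: gT]|, ((repr (enum_val i))^-1 * g)%g \in K.
Proof.
have gK : (g *: K)%g \in lcosets K [set: gT].
  by apply/lcosetsP; exists g; rewrite ?inE.
exists (enum_rank_in gK (g *: K)%g); rewrite enum_rankK_in //.
have /lcosetP[k kK ->] : repr (g *: K)%g \in (g *: K)%g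
  by apply: (mem_repr g); rewrite lcoset_refl.
by rewrite invMg mulgKV groupV.
Qed.

Lemma coef_coset_comb b (i : 'I_#|lcosets K [set: gT]|) h : h \in K ->
  coefg (right_comb iota coset_basis b) (repr (enum_val i) * h)%g =
    coefg (iota (b i 0)) h.
Proof.
move=> hK; rewrite /right_comb coefg_sum (bigD1 i) //= big1 ?addr0 => [|j ji].
  by rewrite coef_deltaM mulKg.
rewrite coef_deltaM (supp_algP _ _ (valP (b j 0))) //.
apply: contra ji => jiK; apply/eqP/enum_val_inj.
have mem_rep (k : 'I_#|lcosets K [set: gT]|) :
    enum_val k = (repr (enum_val k) *: K)%g.
  have /lcosetsP[x _ kx] := enum_valP k.
  rewrite {1}kx; apply/lcoset_eqP; rewrite kx.
  by rewrite lcoset_sym; apply: (mem_repr x); rewrite lcoset_refl.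
rewrite (mem_rep j) (mem_rep i); apply/lcoset_eqP.
by rewrite lcoset_sym mem_lcoset -(groupMr _ hK) -mulgA.
Qed.

Lemma coset_basisP : right_basis iota coset_basis.
Proof.
move=> a.
pose f (i : 'I_#|lcosets K [set: gT]|) := group_alg_of (fun h => if h \in K then
  coefg a (repr (enum_val i) * h)%g else 0) : group_alg P gT.
have fK (i : 'I_#|lcosets K [set: gT]|) : f i \in supp_alg K.
  by apply/supp_algP => g /negPf gK; rewrite coefgE gK.
exists (\col_i (Sub (f i) (fK i) : ab_group_alg P abK)); split=> [|b ab].
  apply: group_algP => g; have [i iK] := coset_basis_repr g.
  rewrite -[g](mulKVg (repr (enum_val i))) coef_coset_comb // mxE.
  by rewrite [iota _]SubK coefgE iK.
apply/matrixP => i j; rewrite mxE ord1; apply/val_inj; rewrite SubK.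
apply: group_algP => h; rewrite coefgE.
case: ifPn => [hK | hK]; first by rewrite ab coef_coset_comb.
by rewrite (supp_algP _ _ (valP (b i 0))).
Qed.

End CosetBasis.

(* For a supported on K, the F[x_1, .., x_n]-linear extension of rK. *)
Definition repr_ext (F : fieldType) (n : nat) (gT : finGroupType)
    (K : {group gT}) (d : nat) (rK : mx_representation F K d)
    (a : group_alg {mpoly F[n]} gT) : 'M[{mpoly F[n]}]_d :=
  \sum_(g in K) coefg a g *: map_mx (@mpolyC n F) (rK g).

(* A family listing each isomorphism class of irreducible representations of K
   exactly once. *)
Definition complete_irr_reprs (F : fieldType) (gT : finGroupType)
    (K : {group gT}) (I : finType) (d : I -> nat)
    (rep : forall i, mx_representation F K (d i)) : Prop :=
  [/\ forall i, mx_irreducible (rep i),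
      forall i j, mx_rsim (rep i) (rep j) -> i = j
    & forall (n : nat) (rK : mx_representation F K n),
        mx_irreducible rK -> exists i, mx_rsim rK (rep i)].

Section GroupDeterminant.

Variables (F : fieldType) (gT : finGroupType).

(* {mpoly F[#|gT|]} is F[x_g], with one variable per element of gT. *)
Definition group_var (g : gT) : {mpoly F[#|gT|]} := 'X_(enum_rank g).

Definition generic_elt : group_alg {mpoly F[#|gT|]} gT :=
  group_alg_of group_var.

Definition group_det : {mpoly F[#|gT|]} :=
  \det (\matrix_(i < #|gT|, j < #|gT|)
          group_var (enum_val i * (enum_val j)^-1)%g).

End GroupDeterminant.

(* Main.v *)
(* Let M be the matrix of left multiplication by X on P[G] in the basis G; its
   determinant is Theta(G).  If a finite family of pairs (T_s, U_s) of
   rectangular matrices satisfies T_s U_t = [s = t], \sum_s U_s T_s = 1 and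
   T_s M = D_s T_s, then \det M = \prod_s \det D_s.  Two such families give the
   two factorizations.
   - s = (phi, b) with b a column index of phi: T_s = (phi(g)_{x b})_{x, g},
     with D_s = phi(X); Schur orthogonality and the regular character provide
     U_s.
   - s = chi: T_s = (chi(coord_i g))_{i, g}, where coord is the vector of
     coordinates in the basis e of P[G] over P[H], with D_s = chi(L_e(X)); U_s
     lists the coefficients of the e_i E_chi, for E_chi the central idempotent
     of chi.  Then \det D_s = chi(Theta(G : H)). *)
Require Import Defs.
From HB Require Import structures.
From mathcomp Require Import all_boot all_order all_algebra all_fingroup.
From mathcomp Require Import all_solvable all_character.
From mathcomp Require Import reals complex.
From mathcomp Require Import mpoly.

Set Implicit Arguments.
Unset Strict Implicit.
Unset Printing Implicit Defensive.

Import GRing.Theory.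

Local Open Scope ring_scope.

(** * Trace and determinant identities *)

Lemma mxtrace_mulmx1 (R : comNzRingType) d (M N : 'M[R]_d) :
  d = 1%N -> \tr (M *m N) = \tr M * \tr N.
Proof. by move=> d1; subst d; rewrite !trace_mx11 mxE big_ord1. Qed.

Lemma sum_enum_val (V : nmodType) (I : finType) (f : I -> V) :
  \sum_(i < #|I|) f (enum_val i) = \sum_i f i.
Proof. by rewrite -(big_enum_val (A := predT)). Qed.

(** Both sides compute the determinant of the block matrix with rows (1, -A) and (B, 1), factored
    into block triangular matrices in two ways. *)
Lemma det_1DmulmxC (R : comNzRingType) m n (A : 'M[R]_(m, n)) (B : 'M_(n, m)) :
  \det (1%:M + A *m B) = \det (1%:M + B *m A).
Proof.
have detl : \det (block_mx 1%:M (- A) B 1%:M) = \det (1%:M + B *m A).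
  have -> : block_mx 1%:M (- A) B 1%:M =
      block_mx 1%:M 0 B 1%:M *m block_mx 1%:M (- A) 0 (1%:M + B *m A).
    rewrite mulmx_block !mul1mx !mulmx1 !mul0mx ?mulmx0 !addr0.
    by rewrite mulmxN addrCA addNr addr0.
  by rewrite det_mulmx det_lblock det_ublock !det1 !mul1r.
have detr : \det (block_mx 1%:M (- A) B 1%:M) = \det (1%:M + A *m B).
  have -> : block_mx 1%:M (- A) B 1%:M =
      block_mx 1%:M (- A) 0 1%:M *m block_mx (1%:M + A *m B) 0 B 1%:M.
    rewrite mulmx_block !mul1mx !mulmx1 !mul0mx ?mulmx0 !add0r.
    by rewrite mulNmx addrK.
  by rewrite det_mulmx det_lblock det_ublock !det1 !mul1r mulr1.
by rewrite -detl detr.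
Qed.

(* With e_s := U s *m T s orthogonal idempotents, M is the product of the
   factors 1 - e_s + U s *m D s *m T s, and det_1DmulmxC moves the determinant
   of each factor to the size k s; no block-diagonal matrix is formed. *)
Lemma det_orthogonal_decomposition (R : comNzRingType) n (S : finType)
    (k : S -> nat) (M : 'M[R]_n) (D : forall s, 'M[R]_(k s))
    (T : forall s, 'M[R]_(k s, n)) (U : forall s, 'M[R]_(n, k s)) :
    (forall s, T s *m M = D s *m T s) ->
    (forall s, T s *m U s = 1%:M) ->
    (forall s t, s != t -> T s *m U t = 0) ->
    \sum_s U s *m T s = 1%:M ->
  \det M = \prod_s \det (D s).
Proof.
move=> TM TU1 TU0 UT.
pose Y s := U s *m ((D s - 1%:M) *m T s).
have detY s : \det (1%:M + Y s) = \det (D s).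
  by rewrite det_1DmulmxC -mulmxA TU1 mulmx1 addrC subrK.
have YY s t : s != t -> Y s *m Y t = 0.
  by move=> st; rewrite /Y -!mulmxA (mulmxA (T s)) TU0 // mul0mx !mulmx0.
have prodY (r : seq S) : uniq r ->
    \prod_(s <- r) \det (1%:M + Y s) = \det (1%:M + \sum_(s <- r) Y s).
  elim: r => [_|s r IH /= /andP[s_r r_uniq]].
    by rewrite !big_nil addr0 det1.
  rewrite !big_cons IH // -det_mulmx mulmxDl !mulmxDr !mul1mx !mulmx1.
  have -> : Y s *m (\sum_(t <- r) Y t) = 0.
    rewrite mulmx_sumr big1_seq // => t /andP[_ tr].
    by rewrite YY //; apply: contraNneq s_r => ->.
  by rewrite addr0 addrAC addrA.
under eq_bigr do rewrite -detY.
rewrite prodY ?index_enum_uniq //; congr (\det _).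
under eq_bigr do rewrite /Y mulmxBl mul1mx mulmxBr -TM mulmxA.
by rewrite sumrB -mulmx_suml UT mul1mx addrC subrK.
Qed.

(** * Schur orthogonality and the regular character *)

Section Orthogonality.

Variables (F : fieldType) (gT : finGroupType) (K : {group gT}).

(** Schur's lemma: the kernel and the image of [f] are submodules, so a nonzero [f] is injective and
    surjective, hence square and invertible. *)
Lemma hom_irr_rsim n1 n2 (r1 : mx_representation F K n1)
    (r2 : mx_representation F K n2) (f : 'M_(n1, n2)) :
    mx_irreducible r1 -> mx_irreducible r2 ->
    {in K, forall x, r1 x *m f = f *m r2 x} ->
  f != 0 -> mx_rsim r1 r2.
Proof.
move=> /mx_irrP[_ irr1] /mx_irrP[_ irr2] hom_f nz_f.
have ker0 : kermx f == 0.
  apply: contraR nz_f => nz_ker; have: row_full (kermx f).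
    apply: irr1 => //; apply/mxmoduleP => x Kx; apply/sub_kermxP.
    by rewrite -mulmxA hom_f // mulmxA mulmx_ker mul0mx.
  by rewrite -sub1mx => /sub_kermxP; rewrite mul1mx => ->.
have full_f : row_full <<f>>%MS.
  apply: irr2; last by rewrite -mxrank_eq0 genmxE mxrank_eq0.
  apply/mxmoduleP => x Kx; rewrite (eqmxMr _ (genmxE f)) genmxE -hom_f //.
  exact: submxMl.
have free_f : row_free f by rewrite -kermx_eq0.
exists f => //; move: free_f full_f.
by rewrite /row_free /row_full genmxE => /eqP f1 /eqP f2; rewrite -f1 f2.
Qed.

Lemma sum_repr_conj_hom n1 n2 (r1 : mx_representation F K n1)
    (r2 : mx_representation F K n2) (f : 'M_(n1, n2)) : {in K, forall x,
  r1 x *m (\sum_(g in K) r1 g *m f *m r2 g^-1%g) =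
    (\sum_(g in K) r1 g *m f *m r2 g^-1%g) *m r2 x}.
Proof.
move=> x Kx; rewrite mulmx_sumr mulmx_suml.
rewrite [RHS](reindex_inj (mulgI x)) /=.
apply: eq_big => g; first by rewrite groupMl.
move=> Kg; rewrite invMg !repr_mxM ?groupV // -!mulmxA.
by have := repr_mxKV r2 Kx 1%:M; rewrite mul1mx => ->; rewrite mulmx1.
Qed.

(** Averaging an elementary matrix turns the sums of the orthogonality relations into entries of an
    intertwiner. *)
Lemma sum_repr_conjE n1 n2 (r1 : mx_representation F K n1)
    (r2 : mx_representation F K n2) a b c e :
  (\sum_(g in K) r1 g *m delta_mx b c *m r2 g^-1%g) a e =
    \sum_(g in K) r1 g a b * r2 g^-1%g c e.
Proof.
rewrite summxE; apply: eq_bigr => g _; rewrite !mxE (bigD1 c) //=.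
rewrite big1 ?addr0 => [|j /negPf jc].
  rewrite mxE (bigD1 b) //= big1 ?addr0 ?mxE ?eqxx ?mulr1 // => i /negPf ib.
  by rewrite mxE ib mulr0.
by rewrite mxE big1 ?mul0r // => i _; rewrite mxE jc andbF mulr0.
Qed.

Lemma schur_orthogonality_neq n1 n2 (r1 : mx_representation F K n1)
    (r2 : mx_representation F K n2) a b c e :
    mx_irreducible r1 -> mx_irreducible r2 -> ~ mx_rsim r1 r2 ->
  \sum_(g in K) r1 g a b * r2 g^-1%g c e = 0.
Proof.
move=> irr1 irr2 nsim; rewrite -sum_repr_conjE.
set f := \sum_(g in K) _; have [-> | nz_f] := eqVneq f 0; first by rewrite mxE.
by case: nsim; apply: hom_irr_rsim nz_f => //; apply: sum_repr_conj_hom.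
Qed.

(** By absolute irreducibility the averaged matrix is a scalar [l], and taking traces determines
    [l *+ n]; the form with [*+ n] avoids a division in [F]. *)
Lemma schur_orthogonality_eq n (r : mx_representation F K n) a b c e :
    mx_absolutely_irreducible r ->
  (\sum_(g in K) r g a b * r g^-1%g c e) *+ n =
    #|K|%:R *+ ((a == e) && (b == c)).
Proof.
move=> absr; rewrite -sum_repr_conjE; set f := \sum_(g in K) _.
have /is_scalar_mxP[l fl] : is_scalar_mx f.
  apply: (mx_abs_irr_cent_scalar absr); apply/centgmxP => x Kx.
  by rewrite sum_repr_conj_hom.
have trf : l *+ n = #|K|%:R *+ (b == c).
  rewrite -mxtrace_scalar -fl linear_sum /=.
  under eq_bigr => g Kg do
    rewrite mxtrace_mulC mulmxA -repr_mxM ?groupV // mulVg repr_mx1 mul1mx.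
  suff -> : \tr (delta_mx b c : 'M[F]_n) = (b == c)%:R.
    by rewrite sumr_const -mulrnA mulnC mulrnA.
  rewrite /mxtrace (bigD1 b) //= big1 ?addr0 ?mxE ?eqxx //.
  by move=> i /negPf ib; rewrite mxE ib.
by rewrite fl mxE -mulrnA mulnC mulrnA trf -mulrnA mulnC mulnb.
Qed.

Hypotheses (F'K : ([pchar F]^'.-group K)%g)
  (splitK : group_splitting_field F K).

Variables (I : finType) (d : I -> nat).
Variable rep : forall i, mx_representation F K (d i).
Hypothesis rep_complete : complete_irr_reprs rep.

(** This is the decomposition of the regular character, carried from the components of the socle to
    the family [rep]. *)
Lemma sum_degree_mxtrace : {in K, forall x,
  \sum_i \tr (rep i x) *+ d i = #|K|%:R *+ (x == 1%g)}.
Proof.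
have [irr_rep rep_inj rep_surj] := rep_complete.
(* The socle exists only classically, so the goal is first made a boolean. *)
move=> x Kx; apply/eqP; wlog sG : / irrType F K by apply: socle_exists.
apply/eqP; pose c i := irr_comp sG (rep i).
have rsim_c i : mx_rsim (rep i) (irr_repr (c i)) by apply: rsim_irr_comp_pchar.
have c_inj : injective c.
  move=> i j cij; apply/rep_inj/(mx_rsim_trans (rsim_c i)).
  by rewrite cij; apply: mx_rsim_sym.
have c_surj (W : sG) : exists i, c i == W.
  have [i /mx_rsim_sym simW] := rep_surj _ _ (socle_irr W).
  exists i; rewrite -[W in X in _ == X](irr_reprK_pchar F'K) /c.
  by rewrite (irr_comp_rsim_pchar _ F'K simW).
pose c' W := xchoose (c_surj W).
have cK W : c (c' W) = W by apply/eqP/(xchooseP (c_surj W)).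
have -> : \sum_i \tr (rep i x) *+ d i =
    \sum_(W : sG) \tr (socle_repr W x) *+ irr_degree W.
  rewrite [RHS](reindex c) /=; last first.
    by exists c' => [i _|W _]; rewrite ?cK //; apply: c_inj; rewrite cK.
  apply: eq_bigr => i _; have sim_i := rsim_c i.
  by rewrite (mxtrace_rsim sim_i) // (mxrank_rsim sim_i).
rewrite -mxtrace_regular_pchar //.
have [-> | ntx] := eqVneq x 1%g; first by rewrite repr_mx1 mxtrace1.
(* Multiplication by [x] different from 1 fixes no group element, so the diagonal is zero. *)
rewrite /mxtrace big1 // => i _; rewrite 2!mxE /=.
rewrite -(inj_eq enum_val_inj) gring_indexK ?groupM ?enum_valP //.
by rewrite eq_mulVg1 mulKg (negbTE ntx).
Qed.

End Orthogonality.

(** * Representations extended to the group algebra *)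

Section GroupAlgebraRepresentation.

Variables (F : fieldType) (n : nat) (gT : finGroupType) (K : {group gT}).
Local Notation P := {mpoly F[n]}.

Lemma repr_ext_linear d (r : mx_representation F K d) c (a b : group_alg P gT) :
  repr_ext r (c *: a + b) = c *: repr_ext r a + repr_ext r b.
Proof.
rewrite /repr_ext scaler_sumr -big_split /=; apply: eq_bigr => g _.
by rewrite coefgD coefgZ scalerDl scalerA.
Qed.

Lemma repr_ext1 d (r : mx_representation F K d) :
  repr_ext r (1 : group_alg P gT) = 1%:M.
Proof.
rewrite /repr_ext (bigD1 1%g) //= coefg1 eqxx scale1r repr_mx1 map_mx1.
by rewrite big1 ?addr0 // => g /andP[_ /negPf g1]; rewrite coefg1 g1 scale0r.
Qed.

(** For h in [K], hg lies in [K] exactly when g does, so support of the left factor suffices. *)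
Lemma repr_extM d (r : mx_representation F K d) (a b : group_alg P gT) :
  a \in supp_alg K -> repr_ext r (a * b) = repr_ext r a *m repr_ext r b.
Proof.
move=> /supp_algP aK; rewrite /repr_ext mulmx_suml.
under eq_bigr do rewrite coefgM scaler_suml.
rewrite exchange_big /= [RHS]big_mkcond /=; apply: eq_bigr => h _.
case: ifPn => [hK | /aK ->]; last first.
  by rewrite big1 // => g _; rewrite mul0r scale0r.
rewrite mulmx_sumr (reindex_inj (mulgI h)) /=.
apply: eq_big => g; first by rewrite groupMl.
rewrite groupMl // => gK; rewrite mulKg repr_mxM // map_mxM.
by rewrite -scalemxAl -scalemxAr scalerA.
Qed.

End GroupAlgebraRepresentation.

(** * The matrix of left multiplication *)

Section LeftMultiplication.

Variables (P : comNzRingType) (gT : finGroupType).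
Local Notation A := (group_alg P gT).

(** Column h lists the coefficients of a h, by [coefgM_delta]. *)
Definition left_mul_mx (a : A) : 'M[P]_#|gT| :=
  \matrix_(i, j) coefg a (enum_val i * (enum_val j)^-1)%g.

Lemma coefgM_delta (a : A) h g :
  coefg (a * delta_alg P h) g = coefg a (g * h^-1)%g.
Proof.
rewrite coefgM (bigD1 (g * h^-1)%g) //= coefgE invMg invgK mulgKV eqxx mulr1.
rewrite big1 ?addr0 // => k kg; rewrite coefgE.
case: eqP => [kgh|]; last by rewrite mulr0.
by rewrite -kgh invMg invgK mulKVg eqxx in kg.
Qed.

Lemma group_alg_sum_delta (a : A) : a = \sum_g coefg a g *: delta_alg P g.
Proof.
apply: group_algP => h; rewrite coefg_sum (bigD1 h) //=.
rewrite coefgZ coefgE eqxx mulr1.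
rewrite big1 ?addr0 // => g /negPf gh.
by rewrite coefgZ coefgE eq_sym gh mulr0.
Qed.

End LeftMultiplication.

Lemma group_detE (F : fieldType) (gT : finGroupType) :
  group_det F gT = \det (left_mul_mx (generic_elt F gT)).
Proof. by congr (\det _); apply/matrixP => g h; rewrite !mxE coefgE. Qed.

(** * Coordinates in a free right module *)

Section RightCoordinates.

Variables (B : comNzRingType) (A : nzRingType) (iota : {rmorphism B -> A}).
Variables (m : nat) (e : 'I_m -> A) (eB : right_basis iota e).

(** [right_coord] is a chosen witness; uniqueness makes it inverse to [right_comb], so the rules
    below follow by exhibiting coordinates. *)
Lemma right_comb_coord b : right_coord eB (right_comb iota e b) = b.
Proof.
have [b' [_ uniq_b']] := eB (right_comb iota e b).
exact: etrans (esym (uniq_b' _ (right_coordK eB _))) (uniq_b' b erefl).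
Qed.

Lemma right_coordD a b :
  right_coord eB (a + b) = right_coord eB a + right_coord eB b.
Proof.
rewrite -[RHS]right_comb_coord; congr right_coord.
rewrite {1}(right_coordK eB a) {1}(right_coordK eB b) /right_comb -big_split /=.
by apply: eq_bigr => i _; rewrite mxE rmorphD mulrDr.
Qed.

Lemma right_coordZ a c : right_coord eB (a * iota c) = c *: right_coord eB a.
Proof.
rewrite -[RHS]right_comb_coord; congr right_coord.
rewrite {1}(right_coordK eB a) /right_comb mulr_suml.
by apply: eq_bigr => i _; rewrite mxE -mulrA -rmorphM mulrC.
Qed.

Lemma right_coord0 : right_coord eB 0 = 0.
Proof. by rewrite -(mul0r (iota 0)) right_coordZ scale0r. Qed.

Lemma right_coord_sum I (r : seq I) (Q : pred I) f :
  right_coord eB (\sum_(i <- r | Q i) f i) =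
    \sum_(i <- r | Q i) right_coord eB (f i).
Proof. exact: (big_morph _ right_coordD right_coord0). Qed.

Lemma right_coord_basis i : right_coord eB (e i) = delta_mx i 0.
Proof.
rewrite -[RHS]right_comb_coord; congr right_coord.
rewrite /right_comb (bigD1 i) //= mxE !eqxx rmorph1 mulr1.
rewrite big1 ?addr0 // => j /negPf ji.
by rewrite mxE ji rmorph0 mulr0.
Qed.

Lemma right_coordM a b :
  right_coord eB (a * b) = left_regular_mx eB a *m right_coord eB b.
Proof.
rewrite {1}(right_coordK eB b) /right_comb mulr_sumr right_coord_sum.
apply/colP => i; rewrite summxE mxE; apply: eq_bigr => j _.
by rewrite mulrA right_coordZ !mxE mulrC.
Qed.

End RightCoordinates.

(** * Factorization over the irreducible representations of the whole group *)

Section GroupDeterminantFactorization.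

Variables (F : fieldType) (n : nat) (gT : finGroupType).
Hypotheses (F'G : ([pchar F]^'.-group [set: gT])%g)
  (splitG : group_splitting_field F [set: gT]%G).
Variables (I : finType) (d : I -> nat).
Variable phi : forall i, mx_representation F [set: gT]%G (d i).
Hypothesis phi_complete : complete_irr_reprs phi.
Local Notation P := {mpoly F[n]}.
Local Notation order := (#|[set: gT]|%:R : F).

Let order_neq0 : order != 0.
Proof. by rewrite natf_neq0_pchar. Qed.

Lemma det_left_mul_irr (a : group_alg P gT) :
  \det (left_mul_mx a) = \prod_i \det (repr_ext (phi i) a) ^+ d i.
Proof.
have [irr_phi phi_inj _] := phi_complete.
pose T (s : {i : I & 'I_(d i)}) : 'M[P]_(d (tag s), #|gT|) :=
  \matrix_(x, g) (phi (tag s) (enum_val g) x (tagged s))%:MP.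
(* The factor degree / order normalizes Schur orthogonality, making [T s *m U s] the identity. *)
pose U (s : {i : I & 'I_(d i)}) : 'M[P]_(#|gT|, d (tag s)) :=
  \matrix_(g, x) ((d (tag s))%:R / order *
                   phi (tag s) (enum_val g)^-1%g (tagged s) x)%:MP.
have TU s t x y : (T s *m U t) x y = ((d (tag t))%:R / order *
    \sum_(g in [set: gT]) phi (tag s) g x (tagged s) *
      phi (tag t) g^-1%g (tagged t) y)%:MP.
  rewrite mxE; under eq_bigr => g _ do rewrite !mxE -mpolyCM mulrCA.
  rewrite (sum_enum_val (fun g => ((d (tag t))%:R / order *
    (phi (tag s) g x (tagged s) * phi (tag t) g^-1%g (tagged t) y))%:MP)).
  by rewrite mulr_sumr raddf_sum; apply: eq_bigl => g; rewrite inE.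
have TUeq i (b c : 'I_(d i)) :
    T (Tagged _ b) *m U (Tagged _ c) = (b == c)%:R%:M.
  apply/matrixP => x y; rewrite TU /= mulrAC mulr_natl.
  rewrite schur_orthogonality_eq ?splitG //.
  by rewrite mulrnAl mulfV // mxE raddfMn /= mpolyC1 -mulrnA mulnb andbC.
rewrite (det_orthogonal_decomposition (D := fun s => repr_ext (phi (tag s)) a)
  (T := T) (U := U)).
(* The factor for (i, b) does not depend on the column b, whence the exponent [d i]. *)
- rewrite -(sig_big_dep xpredT (fun _ => xpredT)
    (fun i _ => \det (repr_ext (phi i) a))) /=.
  by apply: eq_bigr => i _; rewrite prodr_const card_ord.
- move=> [i b]; apply/matrixP => x h; rewrite !mxE /=.
  under eq_bigr do rewrite !mxE /=.
  rewrite (sum_enum_val (fun g => (phi i g x b)%:MP *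
    coefg a (g * (enum_val h)^-1)%g)).
  (* Replacing g by gh lets phi(gh) split as phi(g) phi(h). *)
  rewrite (reindex_inj (mulIg (enum_val h))) /=.
  under [RHS]eq_bigr do rewrite !mxE summxE mulr_suml.
  rewrite exchange_big /= [RHS](eq_bigl xpredT) => [|g]; last by rewrite inE.
  apply: eq_bigr => g _; rewrite mulgK repr_mxM ?inE // mxE.
  rewrite rmorph_sum mulr_suml.
  by apply: eq_bigr => y _; rewrite !mxE rmorphM /= mulrC mulrA.
- by move=> [i b]; rewrite TUeq eqxx.
- move=> [i b] [j c]; have [ij|/eqP ij] := eqVneq i j.
    case: j / ij c => c neq; rewrite TUeq.
    suff /negPf -> : b != c by rewrite raddf0.
    by apply: contraNneq neq => ->.
  move=> _; apply/matrixP => x y; rewrite TU mxE /=.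
  rewrite schur_orthogonality_neq ?mulr0 ?mpolyC0 //.
  by move=> /phi_inj.
apply/matrixP => g h; rewrite summxE [RHS]mxE -(inj_eq enum_val_inj).
set u := enum_val g; set v := enum_val h.
(* Summing over the columns b yields traces; the result is the regular character at u^-1 v divided
   by the order. *)
transitivity (\sum_i ((d i)%:R / order * \tr (phi i (u^-1 * v)%g))%:MP_[n]).
  rewrite /mxtrace; under [RHS]eq_bigr do rewrite mulr_sumr raddf_sum /=.
  rewrite (sig_big_dep xpredT (fun _ => xpredT)) /=.
  apply: eq_bigr => -[i b] _ /=.
  rewrite repr_mxM ?inE // !mxE mulr_sumr raddf_sum; apply: eq_bigr => x _.
  by rewrite !mxE -mpolyCM mulrA.
rewrite -raddf_sum; under eq_bigr do rewrite mulrAC mulr_natl.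
rewrite -mulr_suml sum_degree_mxtrace ?inE // mulrnAl mulfV //.
by rewrite raddfMn /= mpolyC1 -eq_mulVg1.
Qed.

End GroupDeterminantFactorization.

(** * Factorization over the characters of an abelian subgroup *)

Section AbelianFactorization.

Variables (F : fieldType) (n : nat) (gT : finGroupType) (K : {group gT}).
Hypothesis abK : abelian K.
Local Notation P := {mpoly F[n]}.
Local Notation A := (group_alg P gT).
Local Notation B := (ab_group_alg P abK).
Local Notation iota := (val : B -> A).
Local Notation order := (#|K|%:R : F).

Lemma val_ab_algZ c (x : B) : iota (c *: x) = c *: iota x.
Proof. by rewrite linearZ. Qed.

Lemma val_ab_alg_sum (I : finType) (c : I -> P) (x : I -> B) :
  iota (\sum_i c i *: x i) = \sum_i c i *: iota (x i).
Proof. by rewrite raddf_sum; apply: eq_bigr => i _; apply: val_ab_algZ. Qed.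

Section LinearCharacter.

Variables (d : nat) (r : mx_representation F K d).

(* The proof that r has degree 1 is an argument so that lin_char is canonically
   a ring morphism. *)
Definition lin_char of d = 1%N := fun b : B => \tr (repr_ext r (iota b)) : P.

Variable d1 : d = 1%N.

Fact lin_char_linear : linear_for *%R (lin_char d1).
Proof.
by move=> c a b; rewrite /lin_char linearP /= repr_ext_linear linearP.
Qed.

Fact lin_char_monoid_morphism : monoid_morphism (lin_char d1).
Proof.
split=> [|a b]; first by rewrite /lin_char rmorph1 repr_ext1 mxtrace1 d1.
by rewrite /lin_char rmorphM repr_extM ?mxtrace_mulmx1 // [_ \in _](valP _).
Qed.

HB.instance Definition _ :=
  GRing.isLinear.Build P B P *%R (lin_char d1) lin_char_linear.
HB.instance Definition _ :=
  GRing.isMonoidMorphism.Build B P (lin_char d1) lin_char_monoid_morphism.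

Lemma lin_charE b :
  lin_char d1 b = \sum_(g in K) coefg (iota b) g * (\tr (r g))%:MP.
Proof.
rewrite /lin_char /repr_ext raddf_sum; apply: eq_bigr => g _ /=.
by rewrite linearZ /= -trace_map_mx.
Qed.

(** When [r] is irreducible of degree 1, this is the primitive idempotent of its character. *)
Definition lin_idem_elt : A := group_alg_of (fun g =>
  if g \in K then (order^-1 * \tr (r g^-1%g))%:MP else 0).

Fact lin_idem_supp : lin_idem_elt \in supp_alg K.
Proof. by apply/supp_algP => g /negPf gK; rewrite coefgE gK. Qed.

Definition lin_idem : B := Sub lin_idem_elt lin_idem_supp.

Lemma coef_lin_idem g : g \in K ->
  coefg (iota lin_idem) g = (order^-1 * \tr (r g^-1%g))%:MP.
Proof. by move=> Kg; rewrite [iota _]SubK coefgE Kg. Qed.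

End LinearCharacter.

Hypotheses (F'K : ([pchar F]^'.-group K)%g)
  (splitK : group_splitting_field F K).
Variables (J : finType) (d : J -> nat).
Variable chi : forall j, mx_representation F K (d j).
Hypothesis chi_complete : complete_irr_reprs chi.

Let order_neq0 : order != 0.
Proof. by rewrite natf_neq0_pchar. Qed.

Lemma irr_degree1 j : d j = 1%N.
Proof.
have [irr_chi _ _] := chi_complete.
by apply/eqP; rewrite -(abelian_abs_irr (chi j) abK) splitK.
Qed.

Local Notation f j := (lin_char (chi j) (irr_degree1 j)).
Local Notation E j := (lin_idem (chi j)).

Lemma lin_char_idem j k : f j (E k) = (j == k)%:R.
Proof.
have [irr_chi chi_inj _] := chi_complete.
rewrite lin_charE.
under eq_bigr => g Kg do rewrite coef_lin_idem // -mpolyCM -mulrA.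
rewrite -raddf_sum -mulr_sumr.
have -> : \sum_(g in K) \tr (chi k g^-1%g) * \tr (chi j g) = order *+ (j == k).
  rewrite /mxtrace; under eq_bigr do rewrite mulrC big_distrlr.
  rewrite exchange_big; under eq_bigr do rewrite exchange_big /=.
  have [-> | jk] := eqVneq j k; last first.
    rewrite big1 // => x _; rewrite big1 // => y _.
    by rewrite schur_orthogonality_neq // => /chi_inj/eqP; apply/negP.
  (* The degree is 1, so the multiple [*+ d k] in Schur orthogonality disappears. *)
  have orth x y :
      \sum_(g in K) chi k g x x * chi k g^-1%g y y = order *+ (x == y).
    have := schur_orthogonality_eq x x y y (splitK (irr_chi k)); rewrite andbb.
    by set S := \sum_(g in K) _; have -> : S *+ d k = S by rewrite irr_degree1.
  under eq_bigr => x _ do under eq_bigr do rewrite orth.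
  under eq_bigr => x _.
    rewrite (bigD1 x) //= eqxx big1 ?addr0; last first.
      by move=> y /negPf yx; rewrite eq_sym yx.
    over.
  by rewrite sumr_const card_ord irr_degree1.
by rewrite mulrnAr mulVf // raddfMn /= mpolyC1.
Qed.

(** Fourier inversion on [K]: the coefficient at k is recovered through column orthogonality of the
    characters. *)
Lemma sum_lin_char_idem b : \sum_j f j b *: E j = b.
Proof.
apply/val_inj/group_algP => k; rewrite val_ab_alg_sum coefg_sum.
have [Kk | nKk] := boolP (k \in K); last first.
  rewrite (supp_algP _ _ (valP b)) // big1 // => j _.
  by rewrite coefgZ (supp_algP _ _ (valP (E j))) ?mulr0.
under eq_bigr => j _ do rewrite coefgZ coef_lin_idem // lin_charE mulr_suml.
rewrite exchange_big /= -[RHS]mulr1.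
(* In degree 1 the product of the two traces is the trace at g k^-1, so the sum over j is the
   regular character there. *)
have reg g : g \in K ->
    \sum_j (\tr (chi j g))%:MP * (order^-1 * \tr (chi j k^-1%g))%:MP =
      (g == k)%:R :> P.
  move=> Kg; have Kgk := groupM Kg (groupVr Kk).
  have := sum_degree_mxtrace F'K splitK chi_complete Kgk.
  rewrite -eq_mulgV1 => reg_gk.
  under eq_bigr => j _.
    rewrite -mpolyCM mulrCA -(mxtrace_mulmx1 _ _ (irr_degree1 j)).
    rewrite -repr_mxM ?groupV //.
    (* The implicit multiplicity 1 is rewritten as [d j] to match [sum_degree_mxtrace]. *)
    rewrite -[\tr _]mulr1n -{1}(irr_degree1 j).
    over.
  by rewrite -raddf_sum -mulr_sumr reg_gk mulrnAr mulVf // raddfMn /= mpolyC1.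
rewrite (bigD1 k) //= [X in _ + X]big1 ?addr0 => [|g /andP[Kg /negPf gk]].
  by under eq_bigr do rewrite -mulrA; rewrite -mulr_sumr reg // eqxx.
by under eq_bigr do rewrite -mulrA; rewrite -mulr_sumr reg // gk mulr0.
Qed.

Variables (m : nat) (e : 'I_m -> A) (eB : right_basis iota e).

Lemma det_left_mul_Sdet (a : A) :
  \det (left_mul_mx a) = \prod_j lin_char (chi j) (irr_degree1 j) (Sdet eB a).
Proof.
pose T j : 'M[P]_(m, #|gT|) :=
  \matrix_(i, g) f j (right_coord eB (delta_alg P (enum_val g)) i 0).
pose U j : 'M[P]_(#|gT|, m) :=
  \matrix_(g, i) coefg (e i * iota (E j)) (enum_val g).
(* Each coordinate followed by [f j] is P-linear, hence determined on group elements; a scalar of P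
   acts as right multiplication by an element of B. *)
have f_coord j x i : f j (right_coord eB x i 0) =
    \sum_g coefg x g * f j (right_coord eB (delta_alg P g) i 0).
  rewrite {1}(group_alg_sum_delta x) right_coord_sum summxE rmorph_sum /=.
  apply: eq_bigr => g _.
  have -> : coefg x g *: delta_alg P g = delta_alg P g * iota (coefg x g)%:A.
    by rewrite val_ab_algZ rmorph1 -scalerAr mulr1.
  by rewrite right_coordZ mxE rmorphM /= linearZ /= rmorph1 mulr1.
have TU j k : T j *m U k = (j == k)%:R%:M.
  apply/matrixP => i i'; rewrite !mxE.
  under eq_bigr do rewrite !mxE mulrC.
  rewrite (sum_enum_val (fun g => coefg (e i' * iota (E k)) g *
    f j (right_coord eB (delta_alg P g) i 0))).
  (* The sum over g is [f j] of the i-th coordinate of [e i' * iota (E k)], which is [E k] if i = i'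
     and 0 otherwise. *)
  rewrite -f_coord right_coordZ right_coord_basis !mxE rmorphM /= lin_char_idem.
  by rewrite rmorph_nat andbT mulr_natr.
rewrite (@det_orthogonal_decomposition P _ J (fun=> m) (left_mul_mx a)
    (fun j => map_mx (f j) (left_regular_mx eB a)) T U).
- by apply: eq_bigr => j _; rewrite det_map_mx.
- move=> j; apply/matrixP => i h; rewrite !mxE.
  under eq_bigr do rewrite !mxE mulrC -coefgM_delta.
  rewrite (sum_enum_val (fun g => coefg (a * delta_alg P (enum_val h)) g *
    f j (right_coord eB (delta_alg P g) i 0))).
  rewrite -f_coord right_coordM mxE rmorph_sum /=; apply: eq_bigr => k _.
  by rewrite rmorphM !mxE.
- by move=> j; rewrite TU eqxx.
- by move=> j k /negPf jk; rewrite TU jk raddf0.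
have mul_idem x c : \sum_j f j c *: (x * iota (E j)) = x * iota c.
  rewrite -{2}(sum_lin_char_idem c) val_ab_alg_sum mulr_sumr.
  by apply: eq_bigr => j _; rewrite scalerAr.
apply/matrixP => g h; rewrite summxE [RHS]mxE -(inj_eq enum_val_inj).
(* The Kronecker delta is read as the coefficient at g of the group element h, which is expanded in
   the basis [e]; [mul_idem] then splits each coordinate over the characters. *)
rewrite -[RHS](coefgE (fun x => (x == enum_val h)%:R)).
rewrite [group_alg_of _](right_coordK eB).
rewrite /right_comb coefg_sum; under eq_bigr do rewrite mxE.
rewrite exchange_big /=; apply: eq_bigr => i _.
rewrite -mul_idem coefg_sum; apply: eq_bigr => j _.
by rewrite coefgZ !mxE mulrC.
Qed.

End AbelianFactorization.

(* The irreducible representations chi j of the abelian group H are 1 x 1, and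
   \tr reads off the entry of such a matrix. *)
Theorem theorem1p4 (R : realType) (gT : finGroupType) (H : {group gT})
    (abH : abelian H)
    (C := R[i] : fieldType) (P := {mpoly C[#|gT|]} : comNzRingType)
    (A := group_alg P gT) (B := ab_group_alg P abH) (iota := val : B -> A)
    (X := generic_elt C gT : A)
    (I : finType) (d : I -> nat)
    (phi : forall i, mx_representation C [set: gT]%G (d i))
    (phi_complete : complete_irr_reprs phi)
    (J : finType) (dH : J -> nat)
    (chi : forall j, mx_representation C H (dH j))
    (chi_complete : complete_irr_reprs chi)
    (m : nat) (e : 'I_m -> A) (e_basis : right_basis iota e)
    (Theta := Sdet e_basis X) :
  (group_det C gT)%:A = iota (\prod_(i : I)
     \det (map_mx (in_alg B) (repr_ext (phi i) X)) ^+ d i)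
  /\
  iota (\prod_(i : I) \det (map_mx (in_alg B) (repr_ext (phi i) X)) ^+ d i) =
  \prod_(j : J) (\tr (repr_ext (chi j) (iota Theta)))%:A.
Proof.
have splitC (K : {group gT}) : group_splitting_field C K.
  exact: (@group_closure_closed_field (R[i] : closedFieldType)).
have C'K (K : {group gT}) : ([pchar C]^'.-group K)%g.
  (* In characteristic 0 the order of [K] is invertible. *)
  rewrite /pgroup pcharf'_nat (Num.Theory.pnatr_eq0 (R[i] : numFieldType)).
  by rewrite -lt0n cardG_gt0.
have det_irr : group_det C gT = \prod_i \det (repr_ext (phi i) X) ^+ d i.
  by rewrite group_detE (det_left_mul_irr (C'K _) (splitC _) phi_complete).
have iota_irr : iota (\prod_(i : I)
    \det (map_mx (in_alg B) (repr_ext (phi i) X)) ^+ d i) = (group_det C gT)%:A.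
  under eq_bigr do rewrite det_map_mx -rmorphXn.
  by rewrite -rmorph_prod -det_irr /= /iota val_ab_algZ rmorph1.
split=> //; rewrite iota_irr.
rewrite group_detE (det_left_mul_Sdet (C'K _) (splitC _) chi_complete e_basis).
(* [lin_char] unfolds to the trace of the statement, leaving only multiplicativity of the scalar
   embedding. *)
exact: (rmorph_prod (in_alg A)).
Qed.
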